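(* Let $\mathcal T_1,\mathcal T_2$ be rooted binary trees with $m$ nodes each. Then $$\max(\operatorname{HS}(\mathcal T_1),\operatorname{HS}(\mathcal T_2))\le\operatorname{HS}(\mathcal T_1\oplus\mathcal T_2)\le\max(\operatorname{HS}(\mathcal T_1),\operatorname{HS}(\mathcal T_2))+1,$$ and the upper bound is attained (i.e. $\operatorname{HS}(\mathcal T_1\oplus\mathcal T_2)=\max(\operatorname{HS}(\mathcal T_1),\operatorname{HS}(\mathcal T_2))+1$) if and only if all of the following conditions are met: (i) (Max parent) $\operatorname{HS}(\mathcal T_1)\ge\operatorname{HS}(\mathcal T_2)$. (ii) (Full profile) The top right edge of $\mathcal T_1$ has nodes with HS numbers $\operatorname{HS}(\mathcal T_2),\operatorname{HS}(\mathcal T_2)+1,\ldots,\operatorname{HS}(\mathcal T_1)$. (iii) (Escape paths) For each $t\in\{\operatorname{HS}(\mathcal T_2),\ldots,\operatorname{HS}(\mathcal T_1)\}$, the top right edge of $\mathcal T_1$ has a node $v$ with $\operatorname{HS}(v)=t$ that has a child node $w$ located off the top right edge with $\operatorname{HS}(w)=t$. Identical results hold for $\mathcal T_1\ominus\mathcal T_2$ when the top right edge is replaced by the top left edge in these conditions.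
   Context: A rooted binary tree is a finite nonempty rooted tree in which each node has at most one left child and at most one right child. The Horton--Strahler (HS) number of a node $v$ is: $0$ if $v$ has no children; the HS number of the child if $v$ has exactly one child; and $\max(\operatorname{HS}(v_\ell),\operatorname{HS}(v_r))+\mathbf 1_{\{\operatorname{HS}(v_\ell)=\operatorname{HS}(v_r)\}}$ if $v$ has children $v_\ell,v_r$. $\operatorname{HS}(\mathcal T)$ is the HS number of the root of $\mathcal T$. In conditions (ii) and (iii), HS numbers of nodes are computed in $\mathcal T_1$ (before merging). The top right (resp. top left) edge of a rooted binary tree is the path of nodes that starts at the root and repeatedly moves to the right (resp. left) child until the current node has no right (resp. left) child. $\mathcal T_1\oplus\mathcal T_2$ is obtained by making the root of $\mathcal T_2$ the right child of the last node of the top right edge of $\mathcal T_1$; $\mathcal T_1\ominus\mathcal T_2$ is obtained by making the root of $\mathcal T_2$ the left child of the last node of the top left edge of $\mathcal T_1$. *)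

(* Defs.v *)
From mathcomp Require Import all_boot.

Set Implicit Arguments.
Unset Strict Implicit.
Unset Printing Implicit Defensive.

(* [Node l r] has left child [l] and right child [r], each possibly missing;
   trees are nonempty by construction. *)
Inductive tree : Type := Node of option tree & option tree.

Fixpoint num_nodes (T : tree) : nat :=
  let: Node l r := T in
  (if l is Some L then num_nodes L else 0)
  + (if r is Some R then num_nodes R else 0) + 1.

Fixpoint HS (T : tree) : nat :=
  match T with
  | Node None None => 0
  | Node (Some C) None | Node None (Some C) => HS C
  | Node (Some L) (Some R) => maxn (HS L) (HS R) + (HS L == HS R)
  end.

Notation left_side := false (only parsing).
Notation right_side := true (only parsing).

Definition child (d : bool) (T : tree) : option tree :=
  let: Node l r := T in if d then r else l.

(* A node is given by its address: the sequence of sides followed from the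
   root. Distinct nodes are thus distinguished even when the subtrees rooted
   at them are equal. *)
Definition node := seq bool.

(* [None] when [v] is not the address of a node of [T]. *)
Fixpoint subtree (T : tree) (v : node) : option tree :=
  if v is d :: v' then obind (subtree^~ v') (child d T) else Some T.

(* [HS_node T v = Some t] says that [v] is a node of [T] and that its
   Horton-Strahler number is [t]. *)
Definition HS_node (T : tree) (v : node) : option nat := omap HS (subtree T v).

(* The nodes of the top right ([d = true]) or top left ([d = false]) edge,
   listed from the root downwards. *)
Fixpoint top_edge (d : bool) (T : tree) : seq node :=
  let: Node l r := T in
  [::] :: (if (if d then r else l) is Some C then map (cons d) (top_edge d C)
           else [::]).

(* Follow the top edge of [T1] on side [d] down to its last node, whose child on
   side [d] is missing, and make the root of [T2] that child. *)
Fixpoint graft (d : bool) (T1 T2 : tree) : tree :=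
  let: Node l r := T1 in
  if d then Node l (Some (if r is Some R then graft d R T2 else T2))
  else Node (Some (if l is Some L then graft d L T2 else T2)) r.

Definition oplus : tree -> tree -> tree := graft right_side.
Definition ominus : tree -> tree -> tree := graft left_side.

Definition max_parent (T1 T2 : tree) : Prop := HS T2 <= HS T1.

Definition full_profile (d : bool) (T1 T2 : tree) : Prop :=
  forall t : nat, HS T2 <= t <= HS T1 ->
  exists2 v : node, v \in top_edge d T1 & HS_node T1 v = Some t.

Definition escape_paths (d : bool) (T1 T2 : tree) : Prop :=
  forall t : nat, HS T2 <= t <= HS T1 ->
  exists v : node, [/\ v \in top_edge d T1, HS_node T1 v = Some t &
    exists b : bool, let w := rcons v b in
      w \notin top_edge d T1 /\ HS_node T1 w = Some t].

(* Main.v *)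
Require Import Defs.
From mathcomp Require Import all_boot.
From mathcomp Require Import zify.

(** Read the top edge upwards: the value at an edge node is obtained from the
   value [x] at its edge child and the value [a] at its off-edge child by
   [max a x + (a == x)], so grafting [T2] feeds the same recursion with another
   initial value. The grafted value exceeds [max (HS T1) (HS T2)] by one at the
   top exactly when this excess is carried through all levels from [HS T2] to
   [HS T1]. The carry survives a level [t] only if an off-edge child of HS
   number [t] hangs from an edge node of HS number [t]; an off-edge child
   that raises the HS number of [T1] itself absorbs it. *)

Lemma tree_edge_ind (d : bool) (P : tree -> Prop) :
  (forall T, (forall C, child d T = Some C -> P C) -> P T) -> forall T, P T.
Proof.
move=> IH; fix F 1 => -[l r].
(* Recursive calls stay on visible subterms, and [clear F] then keeps automation from making an
   unguarded one. *)
have Pl : if l is Some L then P L else True.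
  by case: l => [L|]; [exact: (F L) | exact: I].
have Pr : if r is Some R then P R else True.
  by case: r {Pl} => [R|]; [exact: (F R) | exact: I].
by apply: IH => C; clear F; case: d => /= eqC; [move: Pr | move: Pl]; rewrite eqC.
Qed.

Definition HS_join (o : option nat) (x : nat) : nat :=
  if o is Some a then maxn a x + (a == x) else x.

Lemma HS_childE (d : bool) (T : tree) :
  HS T = let o := omap HS (child (~~ d) T) in
         if child d T is Some C then HS_join o (HS C) else odflt 0 o.
Proof. by case: T d => [[L|] [R|]] [] //=; rewrite maxnC eq_sym. Qed.

Lemma HS_graftE (d : bool) (T1 T2 : tree) :
  HS (graft d T1 T2) =
  HS_join (omap HS (child (~~ d) T1))
          (if child d T1 is Some C then HS (graft d C T2) else HS T2).
Proof. by case: T1 d => [[L|] [R|]] [] //=; rewrite maxnC eq_sym. Qed.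

Lemma top_edgeE (d : bool) (T : tree) :
  top_edge d T =
  [::] :: (if child d T is Some C then map (cons d) (top_edge d C) else [::]).
Proof. by case: T. Qed.

Lemma mem_top_edge_cons (d b : bool) (T : tree) (v : node) :
  (b :: v \in top_edge d T) =
  (b == d) && (if child d T is Some C then v \in top_edge d C else false).
Proof.
rewrite top_edgeE inE /=; case: (child d T) => [C|]; last by rewrite in_nil andbF.
case: eqP => [->|neq] /=; first by rewrite mem_map // => x y [].
by apply/negP => /mapP [x _ []].
Qed.

Lemma HS_node_nil (T : tree) : HS_node T [::] = Some (HS T).
Proof. by case: T. Qed.

Lemma HS_node_cons (b : bool) (T : tree) (v : node) :
  HS_node T (b :: v) = if child b T is Some C then HS_node C v else None.
Proof. by case: T b => [[L|] [R|]] []. Qed.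

(** One level of [escape_paths], isolated because it unfolds node by node along the edge. *)
Definition escape_at (d : bool) (T : tree) (t : nat) : Prop :=
  exists v : node, [/\ v \in top_edge d T, HS_node T v = Some t &
    exists b : bool, let w := rcons v b in
      w \notin top_edge d T /\ HS_node T w = Some t].

Lemma escape_atE (d : bool) (T : tree) (t : nat) :
  escape_at d T t <->
  (HS T = t /\ omap HS (child (~~ d) T) = Some t) \/
  (if child d T is Some C then escape_at d C t else False).
Proof.
split.
- case=> -[|c v] [].
  + rewrite HS_node_nil => _ [HSt] [b /=]; rewrite mem_top_edge_cons HS_node_cons.
    (* The root's child on side [d] lies on the top edge, so [w] must be the other child. *)
    case: (eqVneq b d) => [->|neq_bd].
      by case: (child d T) => [C|] [] //; rewrite top_edgeE inE.
    have -> : b = ~~ d by case: b d neq_bd => [] [].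
    by case=> _ HSw; left; split=> //; case: (child _ T) HSw => //= C; rewrite HS_node_nil.
  + rewrite mem_top_edge_cons HS_node_cons => /andP [/eqP ->].
    case eqC: (child d T) => [C|] // vC HSv [b] /=.
    rewrite mem_top_edge_cons HS_node_cons eqxx eqC => -[wC HSw].
    by right; exists v; split=> //; exists b.
- case=> [[HSt HSw]|].
  + exists [::]; split; [by rewrite top_edgeE inE | by rewrite HS_node_nil HSt |].
    exists (~~ d); rewrite /= mem_top_edge_cons HS_node_cons.
    by case: (child _ T) HSw => //= C; rewrite HS_node_nil; case: (d).
  + case eqC: (child d T) => [C|] // [v [vC HSv [b [wC HSw]]]].
    exists (d :: v); rewrite mem_top_edge_cons HS_node_cons eqxx eqC.
    split=> //; exists b => /=.
    by rewrite mem_top_edge_cons HS_node_cons eqxx eqC.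
Qed.

Lemma leq_HS_join (o : option nat) (x : nat) : x <= HS_join o x.
Proof. by case: o => [a|] //=; lia. Qed.

(** HS numbers never decrease upwards along the edge. Hence an escape at a level above [HS C] can
    only be at the root. *)
Lemma escape_at_leq (d : bool) (T : tree) (t : nat) :
  escape_at d T t -> t <= HS T.
Proof.
elim/(tree_edge_ind d): T => T IH /escape_atE [[-> //]|].
rewrite (HS_childE d); case eqC: (child d T) => [C|] //= /(IH C eqC) le_tC.
exact: leq_trans le_tC (leq_HS_join _ _).
Qed.

(** Let [a] be the off-edge value at the root. An excess already present at [C] survives if
    [a < HS C], which adds no level, or if [a = HS C + 1], which adds one level with its escape at
    the root. Any other [a] absorbs it. *)
Lemma HS_graft (d : bool) (T1 T2 : tree) :
  maxn (HS T1) (HS T2) <= HS (graft d T1 T2) <= maxn (HS T1) (HS T2) + 1 /\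
  (HS (graft d T1 T2) = maxn (HS T1) (HS T2) + 1 <->
   HS T2 <= HS T1 /\ escape_paths d T1 T2).
Proof.
elim/(tree_edge_ind d): T1 => T IH.
rewrite -[escape_paths d T T2]/(forall t, HS T2 <= t <= HS T -> escape_at d T t).
have E := escape_atE d T; move: E.
rewrite HS_graftE.
have := HS_childE d T.
case eqC: (child d T) => [C|] /=; last first.
  case: (omap HS _) => [a|] /= -> E.
    split; first by lia.
    split=> [Ga | [le_sa /(_ (HS T2))]].
      by split=> [|t le_t]; [lia | apply/E; left; split=> //; [|congr Some]; lia].
    by rewrite leqnn le_sa => /(_ isT) /E [[_ [->]]|//]; lia.
  split; first by lia.
  split=> [|[le_s0 /(_ (HS T2))]]; first by lia.
  by rewrite leqnn le_s0 => /(_ isT) /E [[_]|].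
have [Gle Giff] := IH C eqC.
have leC := @escape_at_leq d C.
case: (omap HS _) => [a|] /= hE E; last first.
  rewrite hE; split=> //; split=> [/Giff [le_s EC]|[le_s ET]].
    by split=> // t le_t; apply/E; right; apply: EC.
  by apply/Giff; split=> // t /ET /E [[]|].
move: Gle Giff; set G := HS (graft d C T2) => Gle Giff.
split; first by case: (leqP (HS T2) (HS C)); lia.
split=> [Gtop|[le_s ET]].
- have [lt_sC|le_sC] := ltnP (HS C) (HS T2).
    (* By [Giff] there is no excess at [C], so [G = HS T2], and only the tie [a = G] at the root can
       create one. *)
    have aE : a = HS T2 by lia.
    by split=> [|t le_t]; [lia | apply/E; left; split=> //; [|congr Some]; lia].
  have [_ EC] : HS T2 <= HS C /\ escape_paths d C T2 by apply/Giff; lia.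
  split=> [|t le_t]; first by lia.
  apply/E; have [le_tC|lt_Ct] := leqP t (HS C).
    by right; apply: EC; lia.
  (* Here [G = HS C + 1], and the only level above [HS C] is [a = HS C + 1]. *)
  by left; split; [|congr Some]; lia.
- have [lt_sC|le_sC] := ltnP (HS C) (HS T2).
    have /E [[hT [aT]]|/leC] := ET (HS T2) ltac:(lia); lia.
  have GC : G = maxn (HS C) (HS T2) + 1.
    apply/Giff; split=> // t le_t.
    (* A root escape at [t <= HS C] would force [a = HS C], but that tie lifts [HS T] to
       [HS C + 1]. *)
    have /E [[hT [aT]]|//] := ET t ltac:(lia); lia.
  have [lt_aC|le_Ca] := ltnP a (HS C); first by lia.
  (* With [a >= HS C], level [HS C + 1] is in range; its escape is at the root, so [a] ties with
     [G]. *)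
  have /E [[hT [aT]]|/leC] := ET (HS C).+1 ltac:(lia); lia.
Qed.

Lemma escape_paths_full_profile (d : bool) (T1 T2 : tree) :
  escape_paths d T1 T2 -> full_profile d T1 T2.
Proof. by move=> ET t /ET [v [vT HSv _]]; exists v. Qed.

Theorem proposition1 (m : nat) (T1 T2 : tree) :
  num_nodes T1 = m -> num_nodes T2 = m ->
  (maxn (HS T1) (HS T2) <= HS (oplus T1 T2) <= maxn (HS T1) (HS T2) + 1
   /\ (HS (oplus T1 T2) = maxn (HS T1) (HS T2) + 1 <->
       [/\ max_parent T1 T2, full_profile right_side T1 T2
         & escape_paths right_side T1 T2]))
  /\
  (maxn (HS T1) (HS T2) <= HS (ominus T1 T2) <= maxn (HS T1) (HS T2) + 1
   /\ (HS (ominus T1 T2) = maxn (HS T1) (HS T2) + 1 <->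
       [/\ max_parent T1 T2, full_profile left_side T1 T2
         & escape_paths left_side T1 T2])).
Proof.
have main d : maxn (HS T1) (HS T2) <= HS (graft d T1 T2) <= maxn (HS T1) (HS T2) + 1
  /\ (HS (graft d T1 T2) = maxn (HS T1) (HS T2) + 1 <->
      [/\ max_parent T1 T2, full_profile d T1 T2 & escape_paths d T1 T2]).
  have [bnd iffG] := HS_graft d T1 T2; split=> //.
  split=> [/iffG [le_s ET]|[le_s _ ET]]; last by apply/iffG.
  by split=> //; apply: escape_paths_full_profile.
by move=> _ _; split; apply: main.
Qed.
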